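(* Let $(A,\cdot,\bullet)$ be a two-sided skew brace with associative $\star$-product, and let $R:=A/[A^{\cdot},A^{\cdot}]$ be the associated radical ring. For every $m\geq 1$, \[P_m(A)=\{1\}\ \Longrightarrow\ R^m=0\ \Longrightarrow\ P_{m+1}(A)=\{1\}.\] Therefore, if $\nu_A:=\min\{n\geq 1: P_n(A)=\{1\}\}$ and $\nu_R:=\min\{n\geq 1: R^n=0\}$ are finite, then $\nu_R\leq\nu_A\leq\nu_R+1$.
   Context: A skew brace is a triple $(A,\cdot,\bullet)$ where $A^{\cdot}=(A,\cdot)$ and $A^{\bullet}=(A,\bullet)$ are groups with the same identity $1$ such that $a\bullet(b\cdot c)=(a\bullet b)\cdot a^{-1}\cdot(a\bullet c)$ for all $a,b,c\in A$, where $a^{-1}$ is the inverse in $A^{\cdot}$. It is two-sided if in addition $(a\cdot b)\bullet c=(a\bullet c)\cdot c^{-1}\cdot(b\bullet c)$ for all $a,b,c$. The $\star$-product is $a\star b:=a^{-1}\cdot(a\bullet b)\cdot b^{-1}$. For associative $\star$, set $P_1(A):=A$ and, for $n\geq 2$, let $P_n(A)$ be the subgroup of $A^{\cdot}$ generated by all products $a_1\star\cdots\star a_n$ with $a_i\in A$. With $D=[A^{\cdot},A^{\cdot}]$ the commutator subgroup of $A^{\cdot}$, under the stated hypotheses $R=A/D$ is a (non-unital) radical ring with (well-defined) operations $(aD)+(bD):=(a\cdot b)D$ and $(aD)(bD):=(a\star b)D$. $R^n$ is the additive subgroup of $R$ generated by all products of $n$ elements of $R$ ($R^1=R$). *)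

(* Defs.v *)
From HB Require Import structures.
From mathcomp Require Import all_boot generic_quotient.
From mathcomp Require Import boolp classical_sets.

Set Implicit Arguments.
Unset Strict Implicit.
Unset Printing Implicit Defensive.

Import Algebra.

Local Open Scope classical_set_scope.
Local Open Scope quotient_scope.
Local Open Scope group_scope.

Reserved Notation "a \bullet b" (at level 40, left associativity).
Reserved Notation "a \star b" (at level 40, left associativity).

(* The [groupType] structure of [A] is the group written with a dot; the two
   groups share the identity [1]. *)
HB.mixin Record Group_isSkewBrace A of Group A := {
  bullet : A -> A -> A;
  bulletV : A -> A;
  bulletA : associative bullet;
  bullet1g : left_id 1 bullet;
  bulletg1 : right_id 1 bullet;
  bulletVg : left_inverse 1 bulletV bullet;
  bulletgV : right_inverse 1 bulletV bullet;
  bulletMr : forall a b c : A,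
    bullet a (b * c) = bullet a b * a^-1 * bullet a c
}.

#[short(type="skewBraceType")]
HB.structure Definition SkewBrace := {A of Group_isSkewBrace A & Group A}.

Notation "a \bullet b" := (bullet a b) : group_scope.

HB.mixin Record SkewBrace_isTwoSided A of SkewBrace A := {
  bulletMl : forall a b c : A,
    (a * b) \bullet c = (a \bullet c) * c^-1 * (b \bullet c)
}.

#[short(type="twoSidedSkewBraceType")]
HB.structure Definition TwoSidedSkewBrace :=
  {A of SkewBrace_isTwoSided A & SkewBrace A}.

Definition star (A : skewBraceType) (a b : A) : A :=
  a^-1 * (a \bullet b) * b^-1.

Notation "a \star b" := (star a b) : group_scope.

Definition gen (G : groupType) (S : set G) : set G :=
  smallest (fun H : set G => group_closed [in H]) S.

Definition zgen (V : zmodType) (S : set V) : set V :=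
  smallest (fun H : set V => zmod_closed [in H]) S.

(* [x_1 op ... op x_n], bracketed to the left, for all [x_1, ..., x_n]. *)
Definition nfold_products (T : Type) (op : T -> T -> T) (n : nat) : set T :=
  [set z | exists x s, (size s).+1 = n /\ z = foldl op x s].

(* [P_n(A)]; the value at [n = 0] is irrelevant. *)
Definition P (A : skewBraceType) (n : nat) : set A :=
  if (n <= 1)%N then setT else gen (nfold_products (@star A) n).
Arguments P A n : clear implicits.

(* Associative rings, not necessarily unital, in which [x + y + x * y] is a
   group law. *)
HB.mixin Record Zmodule_isRadicalRing R of Zmodule R := {
  rmul : R -> R -> R;
  rmulA : associative rmul;
  rmulDl : forall x y z : R, rmul (x + y)%R z = (rmul x z + rmul y z)%R;
  rmulDr : forall x y z : R, rmul x (y + z)%R = (rmul x y + rmul x z)%R;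
  radical_inverse : forall x : R, exists y : R,
    (x + y + rmul x y = 0)%R /\ (y + x + rmul y x = 0)%R
}.

#[short(type="radicalRingType")]
HB.structure Definition RadicalRing := {R of Zmodule_isRadicalRing R & Zmodule R}.

(* [R^n]; the value at [n = 0] is irrelevant. *)
Definition ring_pow (R : radicalRingType) (n : nat) : set R :=
  if (n <= 1)%N then setT else zgen (nfold_products (@rmul R) n).
Arguments ring_pow R n : clear implicits.

(* The least [n >= 1] with [F n = {e}], when there is one. *)
Definition trivial_at (T : Type) (e : T) (F : nat -> set T) : pred nat :=
  fun n => (1 <= n)%N && `[< F n = [set e] >].

Definition nil_index (T : Type) (e : T) (F : nat -> set T)
  (fin : exists n, trivial_at e F n) : nat := ex_minn fin.

Definition derived (G : groupType) : set G :=
  gen [set z | exists x y : G, z = [~ x, y]].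
Arguments derived G : clear implicits.

Lemma gen_closed (G : groupType) (S : set G) : group_closed [in gen S].
Proof.
split; first by apply/mem_set => H [[H1 _] _]; exact: set_mem H1.
move=> x y /set_mem Sx /set_mem Sy; apply/mem_set => H [[H1 HB] SH].
by apply/set_mem/HB; apply/mem_set; [apply: Sx | apply: Sy].
Qed.

Lemma sub_gen (G : groupType) (S : set G) x : S x -> gen S x.
Proof. by move=> Sx H [_]; apply. Qed.

Lemma gen1 (G : groupType) (S : set G) : gen S 1.
Proof. exact/set_mem/(gen_closed S).1. Qed.

Lemma genV (G : groupType) (S : set G) x : gen S x -> gen S x^-1.
Proof.
by move=> /mem_set Sx; apply/set_mem; exact: group_closedV (gen_closed S) _ Sx.
Qed.

Lemma genM (G : groupType) (S : set G) x y : gen S x -> gen S y -> gen S (x * y).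
Proof.
move=> /mem_set Sx /mem_set Sy.
by apply/set_mem; exact: group_closedM (gen_closed S) _ _ Sx Sy.
Qed.

Lemma derived_comm (G : groupType) (x y : G) : derived G [~ x, y].
Proof. by apply: sub_gen; exists x, y. Qed.

Lemma derived_endo (G : groupType) (f : G -> G) :
  {morph f : x y / x * y} -> forall x, derived G x -> derived G (f x).
Proof.
move=> fM; have f1 : f 1 = 1 by apply: (mulgI (f 1)); rewrite -fM !mulg1.
have fV x : f x^-1 = (f x)^-1.
  by apply: (mulgI (f x)); rewrite -fM !mulgV.
move=> x Dx; have := Dx [set z | derived G (f z)]; apply; split.
  split; first by apply/mem_set; rewrite /= f1; exact: gen1.
  move=> u v /set_mem /= Du /set_mem /= Dv; apply/mem_set => /=.
  by rewrite fM fV; apply: genM => //; apply: genV.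
move=> _ [u [v ->]] /=; rewrite /commg /conjg !fM !fV.
exact: derived_comm.
Qed.

Lemma derivedJ (G : groupType) (x y : G) : derived G x -> derived G (x ^ y).
Proof. by move: x; apply: derived_endo => u v; rewrite conjMg. Qed.

(* [same_coset x y] iff [x D = y D]. *)
Definition same_coset (G : groupType) (x y : G) : bool :=
  `[< derived G (x^-1 * y) >].

Lemma same_coset_refl (G : groupType) : reflexive (@same_coset G).
Proof. by move=> x; apply/asboolP; rewrite mulVg; exact: gen1. Qed.

Lemma same_coset_sym (G : groupType) : symmetric (@same_coset G).
Proof.
have H x y : same_coset x y -> @same_coset G y x.
  by move=> /asboolP /genV; rewrite invgM invgK => h; apply/asboolP.
by move=> x y; apply/idP/idP; apply: H.
Qed.

Lemma same_coset_trans (G : groupType) : transitive (@same_coset G).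
Proof.
move=> y x z /asboolP Dxy /asboolP Dyz; apply/asboolP.
by have := genM Dxy Dyz; rewrite mulgA mulgK.
Qed.

Canonical same_coset_equiv (G : groupType) :=
  EquivRel (@same_coset G) (@same_coset_refl G) (@same_coset_sym G)
    (@same_coset_trans G).


Lemma same_cosetM (G : groupType) (x x' y y' : G) :
  same_coset x x' -> same_coset y y' -> same_coset (x * y) (x' * y').
Proof.
move=> /asboolP Dx /asboolP Dy; apply/asboolP.
suff -> : (x * y)^-1 * (x' * y') = (x^-1 * x') ^ y * (y^-1 * y').
  by apply: genM => //; exact: derivedJ.
by rewrite /conjg invgM !mulgA mulgK.
Qed.

Lemma same_cosetV (G : groupType) (x x' : G) :
  same_coset x x' -> same_coset x^-1 x'^-1.
Proof.
move=> /asboolP Dx; apply/asboolP.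
suff -> : x^-1^-1 * x'^-1 = (x^-1 * x')^-1 ^ x^-1.
  by apply: derivedJ; exact: genV.
by rewrite /conjg invgM !invgK !mulgA mulgK.
Qed.

Lemma same_cosetC (G : groupType) (x y : G) : same_coset (x * y) (y * x).
Proof.
apply/asboolP; have := derived_comm y x; congr (derived _ _).
by rewrite /commg /conjg invgM !mulgA.
Qed.

Lemma same_coset_bullet (A : twoSidedSkewBraceType) (a a' b b' : A) :
  same_coset a a' -> same_coset b b' -> same_coset (a \bullet b) (a' \bullet b').
Proof.
move=> /asboolP Da /asboolP Db.
apply: (@same_coset_trans _ (a' \bullet b)); apply/asboolP.
- have -> : a' = a * (a^-1 * a') by rewrite mulVKg.
  set d := a^-1 * a' in Da *; rewrite bulletMl.
  have -> : (a \bullet b)^-1 * ((a \bullet b) * b^-1 * (d \bullet b)) =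
    ((d \bullet b) * b^-1) ^ b by rewrite /conjg !mulgA mulVg mul1g mulgVK.
  apply: derivedJ; move: d Da; apply: derived_endo => u v.
  by rewrite bulletMl !mulgA.
- have -> : b' = b * (b^-1 * b') by rewrite mulVKg.
  set d := b^-1 * b' in Db *; rewrite bulletMr !mulgA mulVg mul1g.
  move: d Db; apply: (@derived_endo _ (fun d => a'^-1 * (a' \bullet d))) => u v.
  by rewrite bulletMr !mulgA.
Qed.

Lemma same_coset_star (A : twoSidedSkewBraceType) (a a' b b' : A) :
  same_coset a a' -> same_coset b b' -> same_coset (a \star b) (a' \star b').
Proof.
move=> Da Db; apply: same_cosetM; last exact: same_cosetV.
by apply: same_cosetM; [exact: same_cosetV | exact: same_coset_bullet].
Qed.

(* The set [A / D] underlying the radical ring of [A]; the hypothesis on the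
   star product makes the multiplication of the ring associative. *)
Definition radical_ring_of (A : twoSidedSkewBraceType)
  (starA : associative (@star A)) : Type := {eq_quot @same_coset A}.

HB.instance Definition _ A starA :=
  EqQuotient.on (@radical_ring_of A starA).
HB.instance Definition _ A starA :=
  Choice.on (@radical_ring_of A starA).

Section RadicalRing.
Variables (A : twoSidedSkewBraceType) (starA : associative (@star A)).
Local Notation R := (radical_ring_of starA).

Definition cls (a : A) : R := \pi_R a.

Lemma clsP (a b : A) : reflect (cls a = cls b) (same_coset a b).
Proof. exact: (@eqmodP _ (same_coset_equiv A)). Qed.

Definition radd (u v : R) : R := cls (repr u * repr v).
Definition ropp (u : R) : R := cls (repr u)^-1.
Definition rstar (u v : R) : R := cls (repr u \star repr v).

Lemma cls_repr (u : R) : cls (repr u) = u.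
Proof. exact: reprK. Qed.

Lemma same_repr (a : A) : same_coset (repr (cls a)) a.
Proof. by apply/clsP; rewrite cls_repr. Qed.

Lemma clsM (a b : A) : radd (cls a) (cls b) = cls (a * b).
Proof. by apply/clsP/same_cosetM; exact: same_repr. Qed.

Lemma clsV (a : A) : ropp (cls a) = cls a^-1.
Proof. by apply/clsP/same_cosetV; exact: same_repr. Qed.

Lemma cls_star (a b : A) : rstar (cls a) (cls b) = cls (a \star b).
Proof. by apply/clsP/same_coset_star; exact: same_repr. Qed.

Lemma raddA : associative radd.
Proof.
move=> u v w; rewrite -[u]cls_repr -[v]cls_repr -[w]cls_repr.
by rewrite !clsM mulgA.
Qed.

Lemma raddC : commutative radd.
Proof. by move=> u v; apply/clsP/same_cosetC. Qed.

Lemma radd0 : left_id (cls 1) radd.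
Proof. by move=> u; rewrite -[u]cls_repr clsM mul1g. Qed.

Lemma raddN : left_inverse (cls 1) ropp radd.
Proof. by move=> u; rewrite -[u]cls_repr clsV clsM mulVg. Qed.

HB.instance Definition _ := isZmodule.Build R raddA raddC radd0 raddN.

Lemma rstarA : associative rstar.
Proof.
move=> u v w; rewrite -[u]cls_repr -[v]cls_repr -[w]cls_repr.
by rewrite !cls_star starA.
Qed.

Lemma clsD (a b : A) : cls (a * b) = (cls a + cls b)%R.
Proof. by rewrite -clsM. Qed.

Lemma clsN (a : A) : cls a^-1 = (- cls a)%R.
Proof. by rewrite -clsV. Qed.

Lemma cls_starE (a b : A) :
  cls (a \star b) = (- cls a + cls (a \bullet b) - cls b)%R.
Proof. by rewrite /star !clsD !clsN. Qed.

Lemma cls_bullet (a b : A) :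
  (cls a + cls b + rstar (cls a) (cls b))%R = cls (a \bullet b).
Proof.
rewrite cls_star cls_starE !addrA [(cls a + cls b)%R]addrC addrK.
by rewrite addrAC subrr add0r.
Qed.

Lemma rstarDl u v w : rstar (u + v)%R w = (rstar u w + rstar v w)%R.
Proof.
rewrite -[u]cls_repr -[v]cls_repr -[w]cls_repr.
move: (repr u) (repr v) (repr w) => a b c.
rewrite -clsD !cls_star !cls_starE bulletMl !clsD !clsN opprD !addrA.
congr (_ - _)%R; rewrite -!addrA; congr (_ + _)%R.
by rewrite !addrA; congr (_ + _)%R; rewrite -addrA addrC.
Qed.

Lemma rstarDr u v w : rstar u (v + w)%R = (rstar u v + rstar u w)%R.
Proof.
rewrite -[u]cls_repr -[v]cls_repr -[w]cls_repr.
move: (repr u) (repr v) (repr w) => a b c.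
rewrite -clsD !cls_star !cls_starE bulletMr !clsD !clsN opprD !addrA.
congr (_ - _)%R; rewrite -!addrA; congr (_ + _)%R; congr (_ + _)%R.
by rewrite addrA addrC.
Qed.

Lemma rstar_inverse u : exists v : R,
  (u + v + rstar u v = 0)%R /\ (v + u + rstar v u = 0)%R.
Proof.
exists (cls (bulletV (repr u))); rewrite -[u]cls_repr.
by rewrite !cls_bullet cls_repr bulletgV bulletVg.
Qed.

HB.instance Definition _ :=
  Zmodule_isRadicalRing.Build R rstarA rstarDl rstarDr rstar_inverse.

End RadicalRing.

Definition radical_ring (A : twoSidedSkewBraceType)
  (starA : associative (@star A)) : radicalRingType := radical_ring_of starA.

(* Main.v *)
From HB Require Import structures.
Require Import Defs.
From mathcomp Require Import all_boot generic_quotient.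
From mathcomp Require Import boolp classical_sets.

Set Implicit Arguments.
Unset Strict Implicit.
Unset Printing Implicit Defensive.

Import Algebra.

Local Open Scope classical_set_scope.

(** The first implication holds because [R] is a quotient of [A] under which
[n]-fold star products map to [n]-fold products. The second one follows from
[D \star A = 1] ([derived_star]): if [R^m = 0], every [m]-fold star product
lies in [D], so every [(m+1)]-fold product [(a_1 \star ... \star a_m) \star a]
is trivial. The inclusion of [D] in the left annihilator is itself a
consequence of the fact that all star products are central in [A] for the
first group law ([star_central]): the identity
[(a * b) \star c = (a \star c) ^ b * (b \star c)] then says that
[a |-> a \star c] is a morphism to an abelian group.

Centrality is obtained in three stages. Let [C] be the centraliser of all
star products, a normal subgroup.

- Expanding [(a * b) \star (c * d)] in two ways shows that [a \bullet b] and
  [b * a] agree modulo [C] ([proj_bullet]). So in the group [A / C] the star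
  product is the commutator operation [[~ a, b^-1]], and associativity makes
  [A / C] nilpotent of class at most two, by a theorem of Levi
  ([associative_commg]).

- Hence triple star products, and commutators of star products with anything,
  lie in [C]. Feeding this into
  [((a * c) \star b) \star d = (a * c) \star (b \star d)] shows that star
  products commute with each other ([star_commute]).

- Computing [(a \bullet b) \star c] once from the associativity of the circle
  operation and once from [a \bullet b = (a * (a \star b)) * b] shows that [b]
  commutes with [a \star ((b \star c) * c)]. Since
  [(b \star c) * c = b^-1 * (b \bullet c)] takes all values as [c] varies, star
  products are central. *)

(** * Groups with an associative commutator operation *)

Section Levi.
Local Open Scope group_scope.

(** Rewriting with this tuple computes normal forms in free groups. *)
Definition gsimpl (G : groupType) :=
  (@mulgA G, @invgM G, @invgK G, @invg1 G, @mulg1 G, @mul1g G,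
   @mulgV G, @mulVg G, @mulgK G, @mulgVK G).

Variable G : groupType.
Implicit Types x y z : G.

Lemma Hall_Witt x y z :
  [~ x, y^-1, z] ^ y * [~ y, z^-1, x] ^ z * [~ z, x^-1, y] ^ x = 1.
Proof. by rewrite /commg /conjg !gsimpl. Qed.

Lemma commgV x y : commute y [~ x, y] -> [~ x, y^-1] = [~ x, y]^-1.
Proof.
move=> cyxy; have -> : [~ x, y^-1] = y * [~ x, y]^-1 * y^-1.
  by rewrite /commg /conjg !gsimpl.
by rewrite (commuteV cyxy) mulgK.
Qed.

Lemma commVg x y : commute x [~ x, y] -> [~ x^-1, y] = [~ x, y]^-1.
Proof.
move=> cxxy; rewrite -[LHS]invgK (invgR x^-1) commgV ?(invgR y) //.
by rewrite -(invgR x); exact: commuteV.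
Qed.

(** The inverse is there because [[~ x, y^-1]] is the shape that the star
product takes in the opposite of a group: [x^-1 * (y * x) * y^-1]. *)
Hypothesis commA : associative (fun x y => [~ x, y^-1]).

(** [y^-1] commutes with itself, so the associativity of [x], [y^-1], [y^-1]
has a trivial side. *)
Lemma associative_commute_commgr x y : commute y [~ x, y].
Proof.
apply/commute_sym/commgP/eqP.
by have := commA x y^-1 y^-1; rewrite /= !invgK invgR commgVg commg1.
Qed.

Lemma associative_commute_commgl x y : commute x [~ x, y].
Proof.
rewrite -[[~ x, y]]invgK; apply/commuteV/commgP/eqP.
by have := commA x x y^-1; rewrite /= !invgK commgVg comm1g.
Qed.

Lemma associative_commgC x y z : [~ x, y, z] = [~ y, z, x]^-1.
Proof.
have := commA x y^-1 z^-1; rewrite /= !invgK => <-.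
rewrite commVg ?invgK ?(invgR _ x) //; exact: associative_commute_commgl.
Qed.

(** Three cyclic rotations, each costing an inversion, give back the same
commutator. *)
Lemma associative_commgV x y z : [~ x, y, z]^-1 = [~ x, y, z].
Proof.
rewrite {1}(associative_commgC x) (associative_commgC y).
by rewrite (associative_commgC z) !invgK.
Qed.

(** Levi's theorem. Triple commutators are invariant under rotation and commute
with their entries, so the Hall-Witt identity makes their cubes trivial, while
[associative_commgV] makes their squares trivial. *)
Theorem associative_commg x y z : [~ x, y, z] = 1.
Proof.
have cycle (u v w : G) : [~ u, v, w] = [~ v, w, u].
  by rewrite associative_commgC associative_commgV.
have hw (u v w : G) : [~ u, v^-1, w] ^ v = [~ u, v, w].
  rewrite commgV; last exact: associative_commute_commgr.
  rewrite commVg; last exact: associative_commute_commgl.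
  rewrite associative_commgV; apply/conjg_fixP/commgP/commute_sym.
  by rewrite cycle cycle; exact: associative_commute_commgr.
have := Hall_Witt x y z; rewrite !hw -(cycle x) (cycle z).
by rewrite -{1}(associative_commgV x) mulVg mul1g.
Qed.

End Levi.

(** * The quotient of a group by a normal subgroup *)

Section Quotient.
Local Open Scope group_scope.
Local Open Scope quotient_scope.

Record normal_subgroup (G : groupType) := NormalSubgroup {
  nset : set G;
  nset1 : nset 1;
  nsetM : forall x y, nset x -> nset y -> nset (x * y);
  nsetV : forall x, nset x -> nset x^-1;
  nsetJ : forall x y, nset x -> nset (x ^ y)
}.

Variables (G : groupType) (N : normal_subgroup G).
Implicit Types x y z : G.

Definition eqmod x y : bool := `[< nset N (x^-1 * y) >].

Lemma eqmod_refl : reflexive eqmod.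
Proof. by move=> x; apply/asboolP; rewrite mulVg; exact: nset1. Qed.

Lemma eqmod_sym : symmetric eqmod.
Proof.
have H x y : eqmod x y -> eqmod y x.
  by move=> /asboolP /nsetV; rewrite invgM invgK => h; apply/asboolP.
by move=> x y; apply/idP/idP; apply: H.
Qed.

Lemma eqmod_trans : transitive eqmod.
Proof.
move=> y x z /asboolP Nxy /asboolP Nyz; apply/asboolP.
by have := nsetM Nxy Nyz; rewrite !gsimpl.
Qed.

Canonical eqmod_equiv := EquivRel eqmod eqmod_refl eqmod_sym eqmod_trans.

Lemma eqmodM x x' y y' : eqmod x x' -> eqmod y y' -> eqmod (x * y) (x' * y').
Proof.
move=> /asboolP Nx /asboolP Ny; apply/asboolP.
suff -> : (x * y)^-1 * (x' * y') = (x^-1 * x') ^ y * (y^-1 * y').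
  by apply: nsetM => //; exact: nsetJ.
by rewrite /conjg !gsimpl.
Qed.

Lemma eqmodV x x' : eqmod x x' -> eqmod x^-1 x'^-1.
Proof.
move=> /asboolP Nx; apply/asboolP.
suff -> : x^-1^-1 * x'^-1 = (x^-1 * x')^-1 ^ x^-1.
  by apply: nsetJ; exact: nsetV.
by rewrite /conjg !gsimpl.
Qed.

Definition quotient_group : Type := {eq_quot eqmod}.

HB.instance Definition _ := EqQuotient.on quotient_group.
HB.instance Definition _ := Choice.on quotient_group.

Definition proj x : quotient_group := \pi_quotient_group x.

Lemma projP x y : reflect (proj x = proj y) (eqmod x y).
Proof. exact: (@eqmodP _ eqmod_equiv). Qed.

Lemma proj_surj (u : quotient_group) : exists x, u = proj x.
Proof. by exists (repr u); rewrite /proj reprK. Qed.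

Lemma eqmod_repr x : eqmod (repr (proj x)) x.
Proof. by apply/projP; rewrite /proj reprK. Qed.

Definition quotient_mul (u v : quotient_group) := proj (repr u * repr v).
Definition quotient_inv (u : quotient_group) := proj (repr u)^-1.

Lemma quotient_mulE x y : quotient_mul (proj x) (proj y) = proj (x * y).
Proof. by apply/projP/eqmodM; exact: eqmod_repr. Qed.

Lemma quotient_invE x : quotient_inv (proj x) = proj x^-1.
Proof. by apply/projP/eqmodV; exact: eqmod_repr. Qed.

Lemma quotient_mulA : associative quotient_mul.
Proof.
move=> u v w; have [x ->] := proj_surj u; have [y ->] := proj_surj v.
by have [z ->] := proj_surj w; rewrite !quotient_mulE mulgA.
Qed.

Lemma quotient_mul1g : left_id (proj 1) quotient_mul.
Proof. by move=> u; have [x ->] := proj_surj u; rewrite quotient_mulE mul1g. Qed.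

Lemma quotient_mulg1 : right_id (proj 1) quotient_mul.
Proof. by move=> u; have [x ->] := proj_surj u; rewrite quotient_mulE mulg1. Qed.

Lemma quotient_mulVg : left_inverse (proj 1) quotient_inv quotient_mul.
Proof.
by move=> u; have [x ->] := proj_surj u; rewrite quotient_invE quotient_mulE mulVg.
Qed.

Lemma quotient_mulgV : right_inverse (proj 1) quotient_inv quotient_mul.
Proof.
by move=> u; have [x ->] := proj_surj u; rewrite quotient_invE quotient_mulE mulgV.
Qed.

HB.instance Definition _ := isGroup.Build quotient_group quotient_mulA
  quotient_mul1g quotient_mulg1 quotient_mulVg quotient_mulgV.

Lemma projM x y : proj (x * y) = proj x * proj y.
Proof. by rewrite -quotient_mulE. Qed.

Lemma projV x : proj x^-1 = (proj x)^-1.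
Proof. by rewrite -quotient_invE. Qed.

Lemma proj_commg x y : proj [~ x, y] = [~ proj x, proj y].
Proof. by rewrite /commg /conjg !projM !projV. Qed.

Lemma proj_eq1 x : proj x = 1 <-> nset N x.
Proof.
split=> [/esym/projP/asboolP|Nx]; first by rewrite invg1 mul1g.
by apply/esym/projP/asboolP; rewrite invg1 mul1g.
Qed.

End Quotient.

(** * Star products are central *)

Section StarCentral.
Local Open Scope group_scope.
Variable A : twoSidedSkewBraceType.
Implicit Types a b c d x y z : A.

Lemma bulletE a b : a \bullet b = a * (a \star b) * b.
Proof. by rewrite /star !gsimpl. Qed.

Lemma star1g a : 1 \star a = 1.
Proof. by rewrite /star bullet1g !gsimpl. Qed.

Lemma starMr a b c : a \star (b * c) = (a \star b) * (a \star c) ^ b^-1.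
Proof. by rewrite /star /conjg bulletMr !gsimpl. Qed.

Lemma starMl a b c : (a * b) \star c = (a \star c) ^ b * (b \star c).
Proof. by rewrite /star /conjg bulletMl !gsimpl. Qed.

Definition star_cent : set A := [set z | forall a b, commute z (a \star b)].

Lemma star_cent1 : star_cent 1.
Proof. by move=> a b; exact/commute_sym/commute1. Qed.

Lemma star_centM x y : star_cent x -> star_cent y -> star_cent (x * y).
Proof. by move=> Cx Cy a b; apply/commute_sym/commuteM; apply/commute_sym. Qed.

Lemma star_centV x : star_cent x -> star_cent x^-1.
Proof. by move=> Cx a b; apply/commute_sym/commuteV/commute_sym. Qed.

Lemma starJ a b c : (a \star c) ^ b^-1 = (a \star b)^-1 * (a \star (b * c)).
Proof. by rewrite starMr mulKg. Qed.

(** By [starJ], conjugates of star products are words in star products. *)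
Lemma star_centJ x y : star_cent x -> star_cent (x ^ y).
Proof.
move=> Cx a b; rewrite -[a \star b](conjgKV y) /commute -!conjMg.
congr (_ ^ y); rewrite starJ; apply: commuteM => //; exact: commuteV.
Qed.

Definition star_centraliser :=
  NormalSubgroup star_cent1 star_centM star_centV star_centJ.

Local Notation pi := (proj star_centraliser).

(** The two expansions of [(a * b) \star (c * d)], after cancellation. *)
Lemma star_exchange a b c d :
  (b \star c) * (a \star d) ^ (b * c^-1) = (a \star d) ^ (c^-1 * b) * (b \star c).
Proof.
have := starMr (a * b) c d; rewrite !starMl !starMr.
move: (a \star c) (a \star d) (b \star c) (b \star d) => p q r s.
rewrite (conjMg p) (conjMg _ s) -!conjgM -!(mulgA (p ^ b)) => /mulgI.
by rewrite [LHS]mulgA [RHS]mulgA => /mulIg.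
Qed.

(** Modulo the centraliser of the star products, the circle operation is the
opposite of the group law: [star_exchange] says that [a \bullet b] and [b * a]
act in the same way on star products. *)
Lemma proj_bullet a b : pi (a \bullet b) = pi b * pi a.
Proof.
pose z := b^-1 * (a \bullet b) * a^-1; suff Cz : star_cent z.
  have -> : a \bullet b = b * z * a by rewrite /z !gsimpl.
  by rewrite 2!projM (proj_eq1 star_centraliser z).2 // mulg1.
move=> c d; have := star_exchange c a b d; move: (c \star d) => x.
rewrite /star /conjg !gsimpl => /mulIg e.
by apply: (@mulgI _ (a^-1 * b)); apply: (@mulIg _ a); rewrite /z !gsimpl e.
Qed.

Lemma proj_star a b : pi (a \star b) = [~ pi a, (pi b)^-1].
Proof. by rewrite /star !projM !projV proj_bullet /commg /conjg !gsimpl. Qed.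

Hypothesis starA : associative (@star A).

(** Levi's theorem in the quotient by the centraliser of the star products. *)
Lemma proj_starR a b y : pi [~ a \star b, y] = 1.
Proof.
rewrite proj_commg proj_star; apply: associative_commg => u v w.
have [a' ->] := proj_surj u; have [b' ->] := proj_surj v.
have [c' ->] := proj_surj w.
by rewrite -(proj_star b') -(proj_star a') -(proj_star a') -proj_star starA.
Qed.

Lemma star_cent_starR a b y : star_cent [~ a \star b, y].
Proof. exact/(proj_eq1 star_centraliser)/proj_starR. Qed.

Lemma star_cent_star_star a b c : star_cent ((a \star b) \star c).
Proof.
by apply/(proj_eq1 star_centraliser); rewrite proj_star -projV -proj_commg proj_starR.
Qed.

(** Conjugation by any [c] changes [a \star b] only by an element that commutes
with star products, so it is enough that [c \star d] commutes with
[(a \star b) ^ c]. That is seen by applying [- \star d] to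
[(a \star b) * c = c * (a \star b) ^ c]. *)
Lemma star_commute a b c d : commute (a \star b) (c \star d).
Proof.
pose V := ((a \star b) \star d) ^ c.
have CV : star_cent V by exact/star_centJ/star_cent_star_star.
have starJE : ((a \star b) ^ c) \star d = V.
  (* Associativity gives the claim up to conjugation by [c \star b], which
     fixes [V]. *)
  apply: (@conjg_inj _ (c \star b)); rewrite [RHS](conjg_fixP _); last first.
    exact/commgP.
  have := starA (a * c) b d; rewrite starMl [in RHS]starMl starMl !starA.
  by move/mulIg.
have : commute (c \star d) ((a \star b) ^ c).
  apply/commgP; apply/conjg_fixP; apply: (@mulIg _ V).
  by rewrite -{1}starJE -starMl -conjgC starMl -/V CV.
move=> h; apply: commute_sym.
have -> : a \star b = (a \star b) ^ c * [~ a \star b, c]^-1.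
  by rewrite /commg invgM invgK mulVKg.
by apply: commuteM => //; apply/commuteV/commute_sym/star_cent_starR.
Qed.

(** The associativity of the circle operation: the automorphism
[x |-> a^-1 * (a \bullet x) = (a \star x) * x] attached to [a \bullet b] is the
composite of those attached to [a] and to [b]. *)
Lemma bullet_star a b c :
  (a \bullet b) \star c = (a \star ((b \star c) * c)) * (b \star c).
Proof.
have -> : (b \star c) * c = b^-1 * (b \bullet c) by rewrite /star !gsimpl.
have e : a \bullet (b \bullet c) =
    (a \bullet b) * a^-1 * (a \bullet (b^-1 * (b \bullet c))).
  by rewrite -bulletMr mulVKg.
by rewrite /star -bulletA e !gsimpl.
Qed.

Lemma star_translation_surj b c : exists c', (b \star c') * c' = c.
Proof.
exists (bulletV b \bullet (b * c)).
by rewrite /star bulletA bulletgV bullet1g mulgVK mulKg.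
Qed.

(** Write [b] as [(c \star b') * b']. Comparing [bullet_star] with the expansion
of [((a * (a \star c)) * c) \star b'] shows that [a \star b] is the conjugate by
[c] of [(a * (a \star c)) \star b']; as star products commute, the latter is
[a \star b] again. *)
Theorem star_central a b c : commute (a \star b) c.
Proof.
have [b' <-] := star_translation_surj c b.
apply/commgP/conjg_fixP; apply: (@mulIg _ (c \star b')).
rewrite -bullet_star bulletE starMl; congr (_ ^ c * _).
have fixJ (u v x y : A) : (u \star v) ^ (x \star y) = u \star v.
  exact/conjg_fixP/commgP/star_commute.
have fixJV (u v x y : A) : (u \star v) ^ (x \star y)^-1 = u \star v.
  exact/conjg_fixP/commgP/commuteV/star_commute.
by rewrite starMl starMr starA fixJ fixJV star_commute.
Qed.

Lemma star_morphl a b c : (a * b) \star c = (a \star c) * (b \star c).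
Proof. by rewrite starMl (conjg_fixP _) //; exact/commgP/star_central. Qed.

Lemma derived_star d c : derived A d -> d \star c = 1.
Proof.
have starV x : x^-1 \star c = (x \star c)^-1.
  by apply: (@mulgI _ (x \star c)); rewrite -star_morphl !mulgV star1g.
move=> /(_ [set z | z \star c = 1]); apply; split.
  split; first by apply/mem_set; exact: star1g.
  move=> x y /set_mem /= x1 /set_mem /= y1; apply/mem_set => /=.
  by rewrite star_morphl starV x1 y1 invg1 mulg1.
move=> _ [x [y ->]] /=; rewrite /commg /conjg !star_morphl !starV.
by apply/eqP/commgP/star_central.
Qed.

End StarCentral.

(** * Comparing the powers of a skew brace and of its ring *)

Section Comparison.
Variables (A : twoSidedSkewBraceType) (starA : associative (@star A)).
Local Notation R := (radical_ring starA).
Local Notation cl := (cls starA : A -> R).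

Lemma cls_eq0 (a : A) : cl a = 0%R -> derived A a.
Proof. by move=> /esym/clsP/asboolP; rewrite invg1 mul1g. Qed.

Lemma cls_surj (u : R) : exists a, u = cl a.
Proof. by exists (repr (u : radical_ring_of starA)); rewrite cls_repr. Qed.

Lemma cls_foldl (a : A) s :
  cl (foldl (@star A) a s) = foldl (@rmul R) (cl a) (map cl s).
Proof.
by elim: s a => //= b s IHs a; rewrite IHs; congr foldl; rewrite -cls_star.
Qed.

Lemma nfold_rmulP n (z : R) : nfold_products (@rmul R) n z ->
  exists2 a, nfold_products (@star A) n a & z = cl a.
Proof.
case=> u [s [sn ->]]; have [a ->] := cls_surj u.
have [t e] : exists t, s = map cl t.
  elim: s {sn} => [|v s [t ->]]; first by exists [::].
  by have [b ->] := cls_surj v; exists (b :: t).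
rewrite e size_map in sn *; exists (foldl (@star A) a t); last by rewrite cls_foldl.
by exists a, t.
Qed.

Lemma P_eq1_ring_pow_eq0 m : P A m = [set 1%g] -> ring_pow R m = [set 0%R].
Proof.
rewrite /P /ring_pow; case: ifP => _ triv; apply/seteqP; split=> // u.
- have [a ->] := cls_surj u => _; have : [set: A] a by [].
  by rewrite triv => ->.
- apply; split=> [|z /nfold_rmulP [a Sa ->]].
    split=> [|x y /set_mem -> /set_mem ->]; first exact/mem_set.
    by apply/mem_set; rewrite subr0.
  by have := sub_gen Sa; rewrite triv => ->.
- move=> -> H [[H0 _] _]; exact: set_mem H0.
Qed.

Lemma ring_pow_eq0_P_eq1 m : (1 <= m)%N ->
  ring_pow R m = [set 0%R] -> P A m.+1 = [set 1%g].
Proof.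
move=> m_gt0 triv; rewrite /P ltnS leqNgt m_gt0 /=.
apply/seteqP; split=> x; last by move=> ->; exact: gen1.
apply; split=> [|_ [a [s [[sm] ->]]]].
  split=> [|y z /set_mem -> /set_mem ->]; first exact/mem_set.
  by apply/mem_set; rewrite mulgV.
case/lastP: s sm => [|s b]; first by move=> m0; rewrite -m0 in m_gt0.
rewrite size_rcons => sm; rewrite foldl_rcons /=; apply: derived_star => //.
apply: cls_eq0; suff: ring_pow R m (cl (foldl (@star A) a s)) by rewrite triv.
rewrite /ring_pow; case: ifP => // _ H [_]; apply.
by exists (cl a), (map cl s); rewrite size_map cls_foldl.
Qed.

End Comparison.

Theorem corollary4p8 (A : twoSidedSkewBraceType)
    (starA : associative (@star A)) (R := radical_ring starA) :
  (forall m : nat, (1 <= m)%N ->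
     (P A m = [set 1%g] -> ring_pow R m = [set 0%R]) /\
     (ring_pow R m = [set 0%R] -> P A m.+1 = [set 1%g])) /\
  (forall (finA : exists n, trivial_at 1%g (P A) n)
          (finR : exists n, trivial_at 0%R (ring_pow R) n),
     (nil_index finR <= nil_index finA)%N /\
     (nil_index finA <= (nil_index finR).+1)%N).
Proof.
split=> [m m_gt0|finA finR].
  by split; [exact: P_eq1_ring_pow_eq0 | exact: ring_pow_eq0_P_eq1].
rewrite /nil_index.
case: (ex_minnP finA) => nA /andP[nA_gt0 /asboolP PA] minA.
case: (ex_minnP finR) => nR /andP[nR_gt0 /asboolP PR] minR; split.
  by apply: minR; rewrite /trivial_at nA_gt0; apply/asboolP/P_eq1_ring_pow_eq0.
by apply: minA; apply/asboolP/(ring_pow_eq0_P_eq1 (starA := starA)).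
Qed.
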